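(* Let $n\in\mathbb{N}$, let $\lambda$ be a partition of $n$ and let $U\in\mathrm{SYT}(\lambda)$. For all cells $x\in\lambda$ and all entries $1\le b\le n$, the drop function can be derived from the signed exit numbers as $$d_U(b,x)=(n-1)!+\sum_{a=1}^{b-1}\Delta_U(a,x).$$ Furthermore, if $U,V\in\mathrm{SYT}(\lambda)$ define equidistributed Novelli--Pak--Stoyanovskii algorithms, that is, $Z_U=Z_V$, then for all $x\in\lambda$ and $1\le b\le n$ we have $d_U(b,x)=d_V(b,x)$.
   Context: A partition $\lambda=(\lambda_1\ge\lambda_2\ge\dots)$ of $n$ is identified with its Young diagram $\{(i,j): i\ge 1,\ 1\le j\le\lambda_i\}$ (English convention: row $i$, column $j$). A tableau of shape $\lambda$ is a bijection $T:\lambda\to\{1,\dots,n\}$; $\mathrm{T}(\lambda)$ is the set of all tableaux. $\mathrm{SYT}(\lambda)\subseteq \mathrm{T}(\lambda)$ is the set of standard Young tableaux, i.e. tableaux increasing along rows from left to right and along columns from top to bottom. For a cell $x=(i,j)\in\lambda$ put $N^-(x)=N_\lambda^-(x)=\{(i-1,j),(i,j-1)\}\cap\lambda$ and $N^+(x)=N_\lambda^+(x)=\{(i+1,j),(i,j+1)\}\cap\lambda$, and define its height $h'_\lambda(x)=(i-1)+(j-1)$. For an entry $b$ and a tableau $T$ put $h'(b,T)=h'_\lambda(T^{-1}(b))$. Novelli--Pak--Stoyanovskii algorithm corresponding to $U\in\mathrm{SYT}(\lambda)$: order the cells by $x\prec_U y :\Leftrightarrow U(x)<U(y)$. Given $T\in\mathrm{T}(\lambda)$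 set $T_0=T$. If $T_s$ is not a standard Young tableau, let $x$ be the $\prec_U$-maximal cell with $N_\lambda^+(x)\neq\emptyset$ and $T_s(x)>\min\{T_s(y):y\in N_\lambda^+(x)\}$, and let $T_{s+1}$ be obtained from $T_s$ by exchanging the entry $T_s(x)$ with the entry $\min\{T_s(y):y\in N_\lambda^+(x)\}$. The process stops at the first tableau $T_r$ which is standard; write $r_U(T)=r$ and $\varphi_U(T)=T_r$. Distribution vector: for $W\in\mathrm{SYT}(\lambda)$ let $z_U(W)=|\{T\in\mathrm{T}(\lambda):\varphi_U(T)=W\}|$, and $Z_U=(z_U(W))_{W\in\mathrm{SYT}(\lambda)}$. Local exchange numbers: for $1\le a<b\le n$ and $x,y\in\lambda$ let $m_U(a,b,x,y)$ be the number of $T\in\mathrm{T}(\lambda)$ such that for some $1\le i\le r_U(T)$ we have $T_{i-1}(x)=a$, $T_{i-1}(y)=b$, $T_i(x)=b$, $T_i(y)=a$. It is known that this does not depend on the choice of $b>a$, and one writes $m_U(a,x,y)=m_U(a,b,x,y)$ for any $b$ with $a<b\le n$. The signed exit number of the entry $a$ (with $1\le a<n$) at the cell $x$ is $$\Delta_U(a,x)=\sum_{y\in N^-(x)}m_U(a,x,y)-\sum_{y\in N^+(x)}m_U(a,y,x).$$ Drop function: for an entry $b$ and $T\in\mathrm{T}(\lambda)$, let $\beta_U(b,T)=\max_{0\le i\le r_U(T)}h'(b,T_i)$ be the maximal height attained by $b$ during the sorting of $T$ (there is a unique cell of this height which contains $b$ at some point). Let $d_U(b,x,T)=1$ if $h'_\lambda(x)=\beta_U(b,T)$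 and $T_i(x)=b$ for some $0\le i\le r_U(T)$, and $d_U(b,x,T)=0$ otherwise. Then $d_U(b,x)=\sum_{T\in\mathrm{T}(\lambda)}d_U(b,x,T)$. *)

(* Defs.v *)
From mathcomp Require Import all_boot all_order all_algebra.
From mathcomp Require Import perm.

Set Implicit Arguments.
Unset Strict Implicit.
Unset Printing Implicit Defensive.

Import GRing.Theory.

Definition is_partition (n : nat) (lam : seq nat) : bool :=
  [&& sorted geq lam, 0 \notin lam & sumn lam == n].

(* The Young diagram; rows and columns are numbered from 0. *)
Definition cell (lam : seq nat) : finType :=
  {i : 'I_(size lam) & 'I_(nth 0 lam i)}.

Definition row_of (lam : seq nat) (x : cell lam) : nat := tag x.
Definition col_of (lam : seq nat) (x : cell lam) : nat := tagged x.

Definition height (lam : seq nat) (x : cell lam) : nat := row_of x + col_of x.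

Definition Nminus (lam : seq nat) (x : cell lam) : {set cell lam} :=
  [set y | ((row_of y).+1 == row_of x) && (col_of y == col_of x)
        || (row_of y == row_of x) && ((col_of y).+1 == col_of x)].

Definition Nplus (lam : seq nat) (x : cell lam) : {set cell lam} :=
  [set y | (row_of y == (row_of x).+1) && (col_of y == col_of x)
        || (row_of y == row_of x) && (col_of y == (col_of x).+1)].

Definition filling (n : nat) (lam : seq nat) : finType :=
  {ffun cell lam -> 'I_n}.

(* Entries are 1, ..., n as in the literature, while 'I_n starts at 0. *)
Definition entry (n : nat) (lam : seq nat) (T : filling n lam) (x : cell lam)
  : nat := (T x).+1.

Definition tableaux (n : nat) (lam : seq nat) : {set filling n lam} :=
  [set T : filling n lam | injectiveb T & [forall k, k \in codom T]].

Definition SYT (n : nat) (lam : seq nat) : {set filling n lam} :=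
  [set T : filling n lam in tableaux n lam |
    [forall x : cell lam, forall y : cell lam,
       ((row_of x == row_of y) && (col_of x < col_of y)
        || (col_of x == col_of y) && (row_of x < row_of y)) ==> (entry T x < entry T y)]].

Section NPS.

Variables (n : nat) (lam : seq nat).
Implicit Types (U T : filling n lam) (x y : cell lam).

(* None if N^+(x) is empty, otherwise the cell of N^+(x) with the least
   entry. *)
Definition minNplus T x : option (cell lam) :=
  if [pick y in Nplus x] is Some y0
  then Some [arg min_(y < y0 in Nplus x) entry T y] else None.

Definition unsorted T x : bool :=
  if minNplus T x is Some y then entry T y < entry T x else false.

Definition next_cell U T : option (cell lam) :=
  [pick x | unsorted T x
          & [forall z, unsorted T z ==> (entry U z <= entry U x)]].

Definition swap T x y : filling n lam := [ffun z => T (tperm x y z)].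

(* The identity on standard tableaux, which have no unsorted cell. *)
Definition step U T : filling n lam :=
  if next_cell U T is Some x then
    if minNplus T x is Some y then swap T x y else T
  else T.

Definition run U T (s : nat) : filling n lam := iter s (step U) T.

(* The least r such that T_r is standard. The length of the searched prefix
   T_0, T_1, ... is no restriction: the tableaux up to and including the first
   standard one are pairwise distinct, since step U is a function. *)
Definition nsteps U T : nat :=
  find [in SYT n lam] (traject (step U) T #|filling n lam|).

Definition nps U T : filling n lam := run U T (nsteps U T).

Definition distribution U (W : filling n lam) : nat :=
  #|[set T in tableaux n lam | nps U T == W]|.

Definition distribution_vector U : {ffun {W : filling n lam | W \in SYT n lam} -> nat} :=
  [ffun W => distribution U (val W)].

Definition exchange_number2 U (a b : nat) x y : nat :=
  #|[set T in tableaux n lam |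
      [exists i : 'I_(nsteps U T),
         [&& entry (run U T i) x == a, entry (run U T i) y == b,
             entry (run U T i.+1) x == b & entry (run U T i.+1) y == a]]]|.

(* m_U(a,b,x,y) is the same for all b with a < b <= n; for 1 <= a < n the
   value b = a + 1 is always available. *)
Definition exchange_number U (a : nat) x y : nat :=
  exchange_number2 U a a.+1 x y.

Definition signed_exit U (a : nat) x : int :=
  (\sum_(y in Nminus x) (exchange_number U a x y)%:Z
   - \sum_(y in Nplus x) (exchange_number U a y x)%:Z)%R.

Definition entry_height (b : nat) T : nat :=
  if [pick x | entry T x == b] is Some x then height x else 0.

Definition max_height U (b : nat) T : nat :=
  \max_(i < (nsteps U T).+1) entry_height b (run U T i).

Definition is_drop U (b : nat) x T : bool :=
  (height x == max_height U b T)
  && [exists i : 'I_(nsteps U T).+1, entry (run U T i) x == b].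

Definition drop_function U (b : nat) x : nat :=
  \sum_(T in tableaux n lam) is_drop U b x T.

End NPS.

(* Main.v *)
Require Import Defs.
From mathcomp Require Import all_boot all_order all_algebra.
From mathcomp Require Import perm zify.

(** Follow one entry b through the sorting of one tableau T.  It stays in its
initial cell until the algorithm starts a slide there; during that slide it
only moves down, each time trading places with a smaller entry; afterwards it
only moves up, each time trading places with a larger entry.  Everything rests
on the second half of this (sliding_settled, settled_below): an entry in a
cell that comes later in the order of U than the cell being treated never
moves down again.

Three consequences are drawn.

Independence of b.  Exchanging the values b and b + 1 in T is a bijection of
the set of tableaux.  The two sorting processes run in parallel until b + 1
moves down past b in one of them, or b and b + 1 are the two entries of N^+(x)
for the cell x being treated.  From then on neither of them moves down past a
smaller entry a < b, so T trades a against b exactly when the relabelled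
tableau trades a against b + 1 (trades_relabel, exchange_number2_eq).

The drop formula.  Let t be the time of the first upward move of b, or the end
of the sorting (turning_point).  The unique cell of maximal height visited by b is the one
that contains it at time t (is_drop_turning).  Counting how often b enters and
leaves a cell x before time t, that is through trades with smaller entries,
gives drop_balance; its sum over all tableaux, where independence of b turns
trade counts into signed exit numbers, is drop_signed_exit.  The initial term
is the number (n-1)! of tableaux with entry b in x.

Equidistribution.  Counting all arrivals and departures of an entry a at x
gives flow_balance, and after summation the linear relation
  (n - a) Delta(a, x) = sum_(c < a) Delta(c, x) + (n-1)!
                        - #|{T | the sorted T has entry a in x}|,
whose last term only depends on the distribution vector.  By induction on a the
distribution vector determines all signed exit numbers
(signed_exit_equidistributed), hence the drop function. *)

Set Implicit Arguments.
Unset Strict Implicit.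
Unset Printing Implicit Defensive.

(** * Cells of a Young diagram *)

Section Cells.

Variable lam : seq nat.
Implicit Types x y z w : cell lam.

Lemma cell_ex i j : j < nth 0 lam i ->
  exists x : cell lam, row_of x = i /\ col_of x = j.
Proof.
move=> lt_j; have lt_i : i < size lam.
  by rewrite ltnNge; apply: contraL lt_j => /(nth_default 0) ->.
by exists (existT _ (Ordinal lt_i) (Ordinal (lt_j : j < nth 0 lam (Ordinal lt_i)))).
Qed.

Lemma col_lt x : col_of x < nth 0 lam (row_of x).
Proof. exact: ltn_ord. Qed.

Lemma Nplus_height x y : y \in Nplus x -> height y = (height x).+1.
Proof. by rewrite inE /height => /orP[] /andP[/eqP-> /eqP->]; lia. Qed.

Lemma mem_Nminus x y : (y \in Nminus x) = (x \in Nplus y).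
Proof. by rewrite !inE; lia. Qed.

End Cells.

(** * Tableaux and single sorting steps *)

Section Fillings.

Variables (n : nat) (lam : seq nat).
Implicit Types (T U : filling n lam) (x y z w : cell lam).

Lemma tableauP T : T \in tableaux n lam -> injective T.
Proof. by rewrite inE => /andP[/injectiveP]. Qed.

Lemma entry_inj T x y : injective T -> entry T x = entry T y -> x = y.
Proof. by move=> injT [/val_inj/injT]. Qed.

Lemma entry_neq T x y : injective T -> x != y -> entry T x != entry T y.
Proof. by move=> injT; apply: contra => /eqP/(entry_inj injT)->. Qed.

Lemma filling_ext T T' : (forall z, entry T z = entry T' z) -> T = T'.
Proof. by move=> E; apply/ffunP => z; apply/val_inj; have [] := E z. Qed.

Lemma entry_swapL T x y : entry (swap T x y) x = entry T y.
Proof. by rewrite /entry ffunE tpermL. Qed.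

Lemma entry_swapR T x y : entry (swap T x y) y = entry T x.
Proof. by rewrite /entry ffunE tpermR. Qed.

Lemma entry_swapD T x y z : z != x -> z != y -> entry (swap T x y) z = entry T z.
Proof. by move=> zx zy; rewrite /entry ffunE tpermD // eq_sym. Qed.

Lemma swap_inj T x y : injective T -> injective (swap T x y).
Proof. by move=> injT z w; rewrite !ffunE => /injT/perm_inj. Qed.

Lemma swap_tableau T x y : T \in tableaux n lam -> swap T x y \in tableaux n lam.
Proof.
rewrite !inE => /andP[/injectiveP injT /forallP surT]; apply/andP; split.
  by apply/injectiveP/swap_inj.
apply/forallP => k; have /codomP[z ->] := surT k.
by apply/codomP; exists (tperm x y z); rewrite ffunE tpermK.
Qed.

Lemma SYT_tableau T : T \in SYT n lam -> T \in tableaux n lam.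
Proof. by rewrite [T \in SYT _ _]inE => /andP[]. Qed.

Lemma SYT_Nplus T x y : T \in SYT n lam -> y \in Nplus x -> entry T x < entry T y.
Proof.
rewrite [T \in SYT _ _]inE => /andP[_ /forallP/(_ x)/forallP/(_ y)/implyP lt_xy] Nxy.
apply: lt_xy; move: Nxy; rewrite inE => /orP[] /andP[/eqP Er /eqP Ec]; lia.
Qed.

(** The cells between two cells of a row or column of a partition diagram lie in
the diagram, so comparing neighbours suffices. *)
Lemma sorted_SYT T : is_partition n lam -> T \in tableaux n lam ->
  (forall x y, y \in Nplus x -> entry T x < entry T y) -> T \in SYT n lam.
Proof.
move=> /and3P[geq_lam _ _] tabT ltT; rewrite [T \in SYT _ _]inE tabT /=.
have rowT d : forall x y, row_of x = row_of y -> col_of y = col_of x + d.+1 ->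
    entry T x < entry T y.
  elim: d => [|d IHd] x y Er Ec.
    by apply: ltT; rewrite inE Er Ec addn1 !eqxx orbT.
  have /cell_ex[z [rz cz]] : (col_of x).+1 < nth 0 lam (row_of x).
    by rewrite Er; apply: leq_ltn_trans (col_lt y); rewrite Ec; lia.
  apply: (@ltn_trans (entry T z)); last by apply: IHd; rewrite ?rz ?cz ?Ec //; lia.
  by apply: ltT; rewrite inE rz cz !eqxx orbT.
have colT d : forall x y, col_of x = col_of y -> row_of y = row_of x + d.+1 ->
    entry T x < entry T y.
  elim: d => [|d IHd] x y Ec Er.
    by apply: ltT; rewrite inE Er Ec addn1 !eqxx.
  have /cell_ex[z [rz cz]] : col_of x < nth 0 lam (row_of x).+1.
    rewrite Ec; apply: leq_trans (col_lt y) _.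
    have geq_trans : transitive geq by move=> a b c ba cb; apply: leq_trans cb ba.
    apply: (sorted_leq_nth geq_trans leqnn 0 geq_lam); rewrite ?inE; last by lia.
      by have := ltn_ord (tag y); rewrite -/(row_of y); lia.
    by have := ltn_ord (tag y); rewrite -/(row_of y); lia.
  apply: (@ltn_trans (entry T z)); last by apply: IHd; rewrite ?rz ?cz ?Er //; lia.
  by apply: ltT; rewrite inE rz cz !eqxx.
apply/forallP => x; apply/forallP => y; apply/implyP => /orP[] /andP[/eqP E lt_xy].
  by apply: (rowT (col_of y - (col_of x).+1)) => //; lia.
by apply: (colT (row_of y - (row_of x).+1)) => //; lia.
Qed.

Lemma unsortedP T x :
  reflect (exists2 y, y \in Nplus x & entry T y < entry T x) (unsorted T x).
Proof.
rewrite /unsorted /minNplus; case: pickP => [y0 Ny0 | N0]; last first.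
  by apply: ReflectF => -[y]; rewrite N0.
case: arg_minnP => // y Ny min_y; apply: (iffP idP) => [lt_y|[z Nz lt_z]].
  by exists y.
exact: leq_ltn_trans (min_y z Nz) lt_z.
Qed.

(** In the order of U, no unsorted cell of T comes after x; x itself may be
sorted. *)
Definition below U T x : Prop :=
  forall z w, w \in Nplus z -> entry T w < entry T z -> entry U z <= entry U x.

(** The algorithm exchanges at T the entry of x with the smaller entry of the
cell y of N^+(x). *)
Definition exchange U T x y : Prop :=
  [/\ y \in Nplus x, entry T y < entry T x,
      forall w, w \in Nplus x -> entry T y <= entry T w & below U T x].

Lemma minNplusE T x y : injective T -> y \in Nplus x ->
  (forall w, w \in Nplus x -> entry T y <= entry T w) -> minNplus T x = Some y.
Proof.
move=> injT Ny min_y; rewrite /minNplus; case: pickP => [y0 Ny0 | /(_ y)]; last by rewrite Ny.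
case: arg_minnP => // z Nz min_z; congr Some; apply: (entry_inj injT).
by apply/eqP; rewrite eqn_leq min_y // min_z.
Qed.

Lemma step_exchange U T x y : injective U -> injective T -> exchange U T x y ->
  step U T = swap T x y.
Proof.
move=> injU injT [Ny lt_y min_y max_x].
have un_x : unsorted T x by apply/unsortedP; exists y.
rewrite /step /next_cell; case: pickP => [z /andP[un_z /forallP max_z] | /(_ x)].
  have -> : z = x.
    apply: (entry_inj injU); apply/eqP; rewrite eqn_leq.
    have /implyP-> := max_z x; rewrite // andbT.
    by have /unsortedP[w] := un_z; apply: max_x.
  by rewrite (minNplusE injT Ny min_y).
case/negP; rewrite un_x; apply/forallP => z; apply/implyP => /unsortedP[w].
exact: max_x.
Qed.

Lemma stepP U T : injective T ->
  (exists x y, exchange U T x y /\ step U T = swap T x y) \/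
  ((forall z w, w \in Nplus z -> entry T z < entry T w) /\ step U T = T).
Proof.
move=> injT; rewrite /step /next_cell; case: pickP => [x /andP[un_x /forallP max_x] | no_un].
  left; have [w Nw lt_w] := unsortedP _ _ un_x.
  rewrite /minNplus; case: pickP => [y0 Ny0 | /(_ w)]; last by rewrite Nw.
  case: arg_minnP => // y Ny min_y; exists x, y; split=> //; split=> //.
    exact: leq_ltn_trans (min_y w Nw) lt_w.
  move=> z v Nv lt_v; have /implyP-> // := max_x z.
  by apply/unsortedP; exists v.
right; split=> // z w Nw; rewrite ltn_neqAle; apply/andP; split.
  apply: entry_neq => //; apply/negP => /eqP E.
  by have := Nplus_height Nw; rewrite E; lia.
rewrite leqNgt; apply/negP => lt_w.
have un_z : unsorted T z by apply/unsortedP; exists w.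
case: (@arg_maxnP _ z (unsorted T) (entry U) un_z) => x un_x max_x.
have /negP[] := no_un x; rewrite un_x; apply/forallP => v; apply/implyP; exact: max_x.
Qed.

(** The entry of a cell increases only when the entry of an upper or left
neighbour moves down into it. *)
Lemma step_gt U T x : injective T -> entry T x < entry (step U T) x ->
  exists2 u, exchange U T u x & entry (step U T) x = entry T u.
Proof.
move=> injT; have [[u [v [exch ->]]]|[_ ->]] := stepP U injT; last by rewrite ltnn.
have [_ lt_v _ _] := exch.
have [->|xu] := eqVneq x u; first by rewrite entry_swapL; lia.
have [->|xv] := eqVneq x v; last by rewrite entry_swapD // ltnn.
by rewrite entry_swapR; exists u.
Qed.

(** The entry of a cell decreases only when it moves down itself. *)
Lemma step_lt U T x : injective T -> entry (step U T) x < entry T x ->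
  exists2 v, exchange U T x v & entry (step U T) x = entry T v.
Proof.
move=> injT; have [[u [v [exch ->]]]|[_ ->]] := stepP U injT; last by rewrite ltnn.
have [_ lt_v _ _] := exch.
have [->|xu] := eqVneq x u; first by rewrite entry_swapL; exists v.
have [->|xv] := eqVneq x v; last by rewrite entry_swapD // ltnn.
by rewrite entry_swapR; lia.
Qed.

Lemma entry_heightE T x b : injective T -> entry T x = b -> entry_height b T = height x.
Proof.
move=> injT Tx; rewrite /entry_height; case: pickP => [y /eqP Ty|/(_ x)].
  by congr height; apply: (entry_inj injT); rewrite Tx.
by rewrite Tx eqxx.
Qed.

Lemma entry_exists T b : T \in tableaux n lam -> 1 <= b <= n -> exists x, entry T x = b.
Proof.
case: b => // b; rewrite inE => /andP[_ /forallP surT] lt_b.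
by have /codomP[x Ex] := surT (Ordinal (lt_b : b < n)); exists x; rewrite /entry -Ex.
Qed.

End Fillings.

(** * Slides *)

Section Run.

Variables (n : nat) (lam : seq nat) (U : filling n lam).
Implicit Types (T : filling n lam) (x y z w : cell lam).

Lemma step_tableau T : T \in tableaux n lam -> step U T \in tableaux n lam.
Proof.
move=> tabT; have [[x [y [_ ->]]]|[_ ->]//] := stepP U (tableauP tabT).
exact: swap_tableau.
Qed.

Lemma step_inj T : injective T -> injective (step U T).
Proof.
move=> injT; have [[x [y [_ ->]]]|[_ ->]//] := stepP U injT.
exact: swap_inj.
Qed.

Lemma run_tableau T k : T \in tableaux n lam -> run U T k \in tableaux n lam.
Proof. by move=> tabT; elim: k => //= k; apply: step_tableau. Qed.

Lemma run_inj T k : injective T -> injective (run U T k).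
Proof. by move=> injT; elim: k => //= k; apply: step_inj. Qed.

Lemma runSr T k : run U T k.+1 = run U (step U T) k.
Proof. exact: iterSr. Qed.

Lemma runD T j k : run U T (j + k) = run U (run U T j) k.
Proof. by rewrite addnC /run iterD. Qed.

Hypothesis USYT : U \in SYT n lam.

Let injU : injective U.
Proof. exact: tableauP (SYT_tableau USYT). Qed.

(** The state of the algorithm inside a slide: the cell with U-entry c is the one
where the slide started, e is the entry that is sliding, and f is another entry
that occupies a cell already treated.  slide_skip says that a cell z above or
left of the sliding entry remains sorted when e is replaced with an entry below
or right of e: this keeps z sorted when e moves on. *)
Record sliding (c e f : nat) T : Prop := Sliding {
  slide_above : forall z, entry T z = e -> c <= entry U z;
  slide_sorted : forall z w, w \in Nplus z -> entry T w < entry T z ->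
    entry U z < c \/ entry T z = e;
  slide_skip : forall z w v, w \in Nplus z -> v \in Nplus w -> entry T w = e ->
    c <= entry U z -> entry T z < entry T v;
  slide_passed : exists2 p, entry T p = f & c <= entry U p;
  slide_other : f <> e }.

(** A slide can be considered to start at any time at the cell being treated. *)
Lemma sliding_start T x p : injective T -> below U T x ->
  entry U x < entry U p -> sliding (entry U x) (entry T x) (entry T p) T.
Proof.
move=> injT max_x lt_xp; split.
- by move=> z /(entry_inj injT)->.
- move=> z w Nw lt_w; have := max_x z w Nw lt_w.
  by rewrite leq_eqVlt => /orP[/eqP/(entry_inj injU)->|]; [right | left].
- move=> z w v Nw _ /(entry_inj injT) E; have := SYT_Nplus USYT Nw.
  by rewrite E; lia.
- by exists p => //; lia.
- by move=> /(entry_inj injT) E; rewrite E ltnn in lt_xp.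
Qed.

Lemma sliding_continue c f T x y : injective T -> exchange U T x y ->
  sliding c (entry T x) f T -> sliding c (entry T x) f (swap T x y).
Proof.
move=> injT [Ny lt_y min_y max_x] [aboveT sortT skipT [p pf pc] fe].
have Uxy := SYT_Nplus USYT Ny; have cx := aboveT x erefl.
have injS := swap_inj (x := x) (y := y) injT.
have Sy z : entry (swap T x y) z = entry T x -> z = y.
  by rewrite -{1}(entry_swapR T x y) => /(entry_inj injS).
have xy : x != y by apply/eqP => E; rewrite E ltnn in lt_y.
have Nne z w : w \in Nplus z -> z != w.
  by move=> Nw; apply/eqP => E; have := SYT_Nplus USYT Nw; rewrite E ltnn.
split=> //.
- by move=> z /Sy->; lia.
- move=> z w Nw lt_w; have zw := Nne _ _ Nw.
  have [zy|zy] := eqVneq z y; first by right; rewrite zy entry_swapR.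
  have [zx|zx] := eqVneq z x.
    rewrite zx in Nw zw lt_w; move: lt_w; rewrite entry_swapL.
    have [->|wy] := eqVneq w y; first by rewrite entry_swapR; lia.
    rewrite entry_swapD //; last by rewrite eq_sym.
    by have := min_y w Nw; lia.
  have Tz : entry T z <> entry T x by move=> /(entry_inj injT) E; rewrite E eqxx in zx.
  left; move: lt_w; rewrite [entry _ z]entry_swapD //.
  have [wx|wx] := eqVneq w x.
    rewrite wx entry_swapL ltnNge => /negP le_z; rewrite wx in Nw.
    by rewrite ltnNge; apply/negP => cz; apply: le_z; apply/ltnW/(skipT z x).
  have [wy|wy] := eqVneq w y.
    rewrite wy entry_swapR => lt_z; rewrite wy in Nw.
    by have [|//|//] := sortT z y Nw; lia.
  by rewrite entry_swapD // => lt_z; have [|//|//] := sortT z w Nw.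
- move=> z w v Nw Nv /Sy wy cz; rewrite {}wy in Nw Nv.
  have vy : v != y by rewrite eq_sym Nne.
  have vx : v != x.
    by apply/eqP => E; have := SYT_Nplus USYT Nv; rewrite E; lia.
  rewrite (entry_swapD _ vx vy).
  have lt_yv : entry T y < entry T v.
    rewrite ltn_neqAle entry_neq 1?eq_sym //= leqNgt; apply/negP => lt_v.
    have [|/(entry_inj injT) yx] := sortT y v Nv lt_v; first by lia.
    by rewrite yx eqxx in xy.
  have [->|zx] := eqVneq z x; first by rewrite entry_swapL.
  have zy : z != y by apply: Nne.
  rewrite (entry_swapD _ zx zy); apply: leq_ltn_trans lt_yv.
  rewrite leqNgt; apply/negP => lt_z.
  by have [|/(entry_inj injT) E] := sortT z y Nw lt_z; [lia | rewrite E eqxx in zx].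
- have [py|py] := eqVneq p y.
    by exists x => //; rewrite entry_swapL -py.
  have px : p != x by apply/eqP => E; apply: fe; rewrite -pf E.
  by exists p => //; rewrite entry_swapD.
Qed.

(** If the exchanged cell x does not contain the sliding entry e, the slide of e
is over and a new one starts at x. *)
Lemma sliding_exchange c e f T x y : injective T -> exchange U T x y ->
  sliding c e f T ->
  entry T x <> f /\ exists c' e', sliding c' e' f (swap T x y).
Proof.
move=> injT exch_xy J; have [Ny lt_y _ max_x] := exch_xy.
have [[p pf pc] fe] := (slide_passed J, slide_other J).
have [xe|xe] := eqVneq (entry T x) e.
  split; first by rewrite xe; apply: nesym.
  by exists c, e; rewrite -xe in J *; apply: sliding_continue.
have Uxc : entry U x < c.
  by have [//|E] := slide_sorted J Ny lt_y; rewrite E eqxx in xe.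
have Uxp : entry U x < entry U p by apply: leq_trans pc.
split; first by rewrite -pf => /(entry_inj injT) E; rewrite E ltnn in Uxp.
exists (entry U x), (entry T x); apply: sliding_continue => //.
by rewrite -pf; apply: sliding_start.
Qed.

(** From T on, the entry b never moves down. *)
Definition settled T b := forall k x y,
  exchange U (run U T k) x y -> entry (run U T k) x <> b.

Lemma settled_run T b k : settled T b -> settled (run U T k) b.
Proof. by move=> set_b j x y; rewrite -runD; apply: set_b. Qed.

Lemma sliding_settled c e f T : injective T -> sliding c e f T -> settled T f.
Proof.
move=> injT J k.
have injk j : injective (run U T j) by apply: run_inj.
suff [c' [e' Jk]] : exists c' e', sliding c' e' f (run U T k).
  by move=> x y exch; have [] := sliding_exchange (injk k) exch Jk.
elim: k => [|k [c' [e' Jk]]]; first by exists c, e.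
have [[x [y [exch E]]]|[_ E]] := stepP U (injk k); rewrite /= -/(run U T k) E; last by exists c', e'.
by have [] := sliding_exchange (injk k) exch Jk.
Qed.

Lemma settled_below T x p : injective T -> below U T x ->
  entry U x < entry U p -> settled T (entry T p).
Proof. by move=> injT max_x lt_xp; apply: sliding_settled (sliding_start _ max_x lt_xp). Qed.

(** Once an entry has moved up, it never moves down again. *)
Lemma settled_up T x y : injective T -> exchange U T x y -> settled T (entry T y).
Proof.
by move=> injT [Ny _ _ max_x]; apply: settled_below max_x (SYT_Nplus USYT Ny).
Qed.

(** An entry b + 1 that trades places with b stops there: the entries below the
old place of b exceed b, hence also b + 1. *)
Lemma settled_consecutive T x y : injective T -> exchange U T x y ->
  entry T x = (entry T y).+1 -> settled (step U T) (entry T x).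
Proof.
move=> injT exch Exy; have [Ny lt_y min_y max_x] := exch.
rewrite (step_exchange injU injT exch) -(entry_swapR T x y).
have Uxy := SYT_Nplus USYT Ny.
apply: (@settled_below _ x) => //; first exact: swap_inj.
move=> z w Nw; have Uzw := SYT_Nplus USYT Nw.
have [->//|zx] := eqVneq z x.
have [wx|wx] := eqVneq w x; first by rewrite wx in Uzw => _; apply: ltnW.
have [wy|wy] := eqVneq w y.
  have zy : z != y by apply/eqP => E; rewrite E wy ltnn in Uzw.
  rewrite wy entry_swapR entry_swapD // => lt_z; rewrite wy in Nw.
  by apply: (max_x z y) => //; lia.
rewrite (entry_swapD _ wx wy); have [zy|zy] := eqVneq z y.
  rewrite zy entry_swapR => lt_w; rewrite zy in Nw; apply: (max_x y w Nw).
  have := entry_neq injT wy; lia.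
by rewrite entry_swapD //; apply: max_x.
Qed.

End Run.

(** * Termination *)

Section Termination.

Variables (n : nat) (lam : seq nat) (U : filling n lam).
Implicit Types (T : filling n lam) (x y z w : cell lam).

Lemma step_SYT T : T \in SYT n lam -> step U T = T.
Proof.
move=> sytT; have injT := tableauP (SYT_tableau sytT).
have [[x [y [[Ny lt_y _ _] _]]]|[]//] := stepP U injT.
by have := SYT_Nplus sytT Ny; lia.
Qed.

Hypothesis lam_part : is_partition n lam.

(** Each exchange moves the larger entry down by one and the smaller entry up by
one, so it increases this sum by the difference of the two. *)
Definition potential T := \sum_x entry T x * height x.

Lemma potential_step T : T \in tableaux n lam -> T \notin SYT n lam ->
  potential T < potential (step U T).
Proof.
move=> tabT nsytT; have injT := tableauP tabT.
have [[x [y [[Ny lt_y _ _] ->]]]|[sortT _]] := stepP U injT; last first.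
  by rewrite sorted_SYT in nsytT.
have xy : y != x by apply/eqP => E; rewrite E ltnn in lt_y.
rewrite /potential (bigD1 x) //= (bigD1 y) //= [X in _ < X](bigD1 x) //=.
rewrite [X in _ < _ + X](bigD1 y) //= entry_swapL entry_swapR.
rewrite (Nplus_height Ny) !addnA.
under [X in _ < _ + X]eq_bigr => z /andP[zx zy] do rewrite entry_swapD //.
by rewrite ltn_add2r; nia.
Qed.

Hypothesis USYT : U \in SYT n lam.

(** Otherwise the searched prefix would consist of as many distinct fillings as
there are, and would contain U, which is standard. *)
Lemma nps_SYT T : T \in tableaux n lam -> nps U T \in SYT n lam.
Proof.
move=> tabT; rewrite /nps /nsteps; set s := traject _ _ _.
have [has_s|no_s] := boolP (has [in SYT n lam] s).
  have := nth_find T has_s; rewrite nth_traject //.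
  by rewrite has_find size_traject in has_s.
have ns i : i < #|filling n lam| -> run U T i \notin SYT n lam.
  move=> lt_i; apply: contra no_s => syt_i; apply/hasP; exists (run U T i) => //.
  by apply/trajectP; exists i.
have lt_pot i j : i < j -> j < #|filling n lam| ->
    potential (run U T i) < potential (run U T j).
  elim: j => // j IHj; rewrite ltnS leq_eqVlt => /orP[/eqP->|lt_ij] lt_j.
    by apply: potential_step; [apply: run_tableau | apply/ns/ltnW].
  apply: ltn_trans (IHj lt_ij (ltnW lt_j)) _.
  by apply: potential_step; [apply: run_tableau | apply/ns/ltnW].
have uniq_s : uniq (U :: s).
  rewrite /= andbC; apply/andP; split.
    apply/(uniqP T) => i j; rewrite !inE size_traject => lt_i lt_j.
    rewrite !nth_traject // => E.
    have [lt_ij|lt_ji|//] := ltngtP i j.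
      by have := lt_pot i j lt_ij lt_j; rewrite /run E ltnn.
    by have := lt_pot j i lt_ji lt_i; rewrite /run E ltnn.
  by apply/trajectP => -[i lt_i E]; have := ns i lt_i; rewrite /run -E USYT.
have := max_card (mem (U :: s)); rewrite (card_uniqP uniq_s) /= size_traject.
by rewrite ltnn.
Qed.

Lemma run_after T k : T \in tableaux n lam -> nsteps U T <= k -> run U T k = nps U T.
Proof.
move=> tabT /subnKC <-; rewrite runD -/(nps U T).
by elim: (k - _) => //= m ->; apply/step_SYT/nps_SYT.
Qed.

End Termination.

(** * Independence of the larger entry *)

Section Independence.

Variables (n : nat) (lam : seq nat) (U : filling n lam).
Hypothesis USYT : U \in SYT n lam.
Implicit Types (T : filling n lam) (x y z w : cell lam).

Let injU : injective U.
Proof. exact: tableauP (SYT_tableau USYT). Qed.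

(** The step from T trades the entry a of x against the entry b of y. *)
Definition trade a b x y T : bool :=
  [&& entry T x == a, entry T y == b,
      entry (step U T) x == b & entry (step U T) y == a].

(** The larger entry is the one that moves down, so y is the upper cell. *)
Lemma trade_exchange a b x y T : injective T -> a < b -> trade a b x y T ->
  exchange U T y x.
Proof.
move=> injT lt_ab /and4P[/eqP Tx /eqP Ty /eqP Sx /eqP Sy].
have [[u [v [exch E]]]|[_ E]] := stepP U injT; last by rewrite E in Sx; lia.
have [_ lt_v _ _] := exch; rewrite E in Sx Sy.
have [xu|xu] := eqVneq x u; first by move: Sx Tx; rewrite xu entry_swapL; lia.
have [xv|xv] := eqVneq x v; last by rewrite entry_swapD // in Sx; lia.
rewrite xv entry_swapR in Sx *.
by have -> : y = u by apply: (entry_inj injT); rewrite Ty.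
Qed.

(** Some step of the process started at T, of unbounded length, makes the trade;
steps after the first standard tableau are trivial. *)
Definition trades a b x y T : Prop := exists k, trade a b x y (run U T k).

Lemma tradesS a b x y T :
  trades a b x y T <-> trade a b x y T \/ trades a b x y (step U T).
Proof.
split=> [[[|k]] tr|[tr|[k tr]]]; [by left| |by exists 0|].
  by right; exists k; rewrite -runSr.
by exists k.+1; rewrite runSr.
Qed.

Lemma settled_trades a b x y T : injective T -> a < b -> settled U T b ->
  ~ trades a b x y T.
Proof.
move=> injT lt_ab set_b [k tr].
apply: (set_b k y x); first by apply: trade_exchange tr => //; apply: run_inj.
by have /and4P[_ /eqP] := tr.
Qed.

Variables (i j : 'I_n).
Hypothesis ij : j = i.+1 :> nat.
Let b := i.+1.

(** Exchanging the values i and j of a filling, that is, when j = i + 1, the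
entries b and b + 1. *)
Definition relabel T : filling n lam := [ffun z => tperm i j (T z)].

(** The effect of relabel on entries. *)
Definition flip v := if v == b then b.+1 else if v == b.+1 then b else v.

Lemma flipP v : [\/ v = b /\ flip v = b.+1, v = b.+1 /\ flip v = b |
  v <> b /\ v <> b.+1 /\ flip v = v].
Proof.
rewrite /flip; case: eqP => [->|vb]; first by constructor 1.
by case: eqP => [->|vb1]; [constructor 2 | constructor 3].
Qed.

Lemma flip_b : flip b = b.+1. Proof. by rewrite /flip eqxx. Qed.

Lemma flip_b1 : flip b.+1 = b.
Proof. by rewrite /flip eqxx; case: eqP; lia. Qed.

Lemma relabelK : involutive relabel.
Proof. by move=> T; apply/ffunP => z; rewrite !ffunE tpermK. Qed.

Lemma relabel_inj T : injective T -> injective (relabel T).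
Proof. by move=> injT z w; rewrite !ffunE => /perm_inj/injT. Qed.

Lemma relabel_tableau T : (relabel T \in tableaux n lam) = (T \in tableaux n lam).
Proof.
suff sub T' : T' \in tableaux n lam -> relabel T' \in tableaux n lam.
  by apply/idP/idP => [/sub|/sub//]; rewrite relabelK.
rewrite !inE => /andP[/injectiveP injT /forallP surT]; apply/andP; split.
  exact/injectiveP/relabel_inj.
apply/forallP => k; have /codomP[z Ez] := surT (tperm i j k).
by apply/codomP; exists z; rewrite ffunE -Ez tpermK.
Qed.

Lemma entry_relabel T z : entry (relabel T) z = flip (entry T z).
Proof.
rewrite /entry ffunE /flip /b !eqSS -ij.
case: tpermP => [->|->|/eqP Ti /eqP Tj]; rewrite ?eqxx ?ij //; first by case: eqP; lia.
by rewrite -!val_eqE /= in Ti Tj; rewrite (negbTE Ti) -ij (negbTE Tj).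
Qed.

Lemma relabel_swap T x y : relabel (swap T x y) = swap (relabel T) x y.
Proof. by apply/ffunP => z; rewrite !ffunE. Qed.

Lemma trade_relabel a x y T : a < b -> step U (relabel T) = relabel (step U T) ->
  trade a b x y T = trade a b.+1 x y (relabel T).
Proof.
move=> lt_ab E; rewrite /trade E !entry_relabel.
have fa v : (flip v == a) = (v == a) by have [] := flipP v; lia.
have fb v : (flip v == b.+1) = (v == b) by have [] := flipP v; lia.
by rewrite !fa !fb.
Qed.

(** The entries b and b + 1 are the two entries of N^+(x). *)
Definition forked T x : bool :=
  (b \in [seq entry T w | w in Nplus x]) && (b.+1 \in [seq entry T w | w in Nplus x]).

Lemma forkedP T x : reflect (exists w w',
  [/\ w \in Nplus x, w' \in Nplus x, entry T w = b & entry T w' = b.+1]) (forked T x).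
Proof.
apply: (iffP andP) => [[/imageP[w Nw Tw] /imageP[w' Nw' Tw']]|[w [w' [Nw Nw' Tw Tw']]]].
  by exists w, w'.
by split; apply/imageP; [exists w | exists w'].
Qed.

Lemma forked_relabel T x : forked T x -> forked (relabel T) x.
Proof.
move=> /forkedP[w [w' [Nw Nw' Tw Tw']]]; apply/forkedP; exists w', w; split=> //.
  by rewrite entry_relabel Tw' flip_b1.
by rewrite entry_relabel Tw flip_b.
Qed.

Lemma forked_below T x : injective T -> forked T x -> below U T x ->
  below U (relabel T) x.
Proof.
move=> injT /forkedP[w [w' [Nw Nw' Tw Tw']]] max_x z v Nv; rewrite !entry_relabel.
have lt_v := max_x z v Nv.
have hyp : entry T z = b -> entry T v = b.+1 -> False.
  rewrite -Tw' -Tw => /(entry_inj injT) zw /(entry_inj injT) vw'.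
  have := Nplus_height Nv; rewrite zw vw'.
  by rewrite (Nplus_height Nw) (Nplus_height Nw'); lia.
move=> lt_fv; apply: lt_v.
by have [] := flipP (entry T z); have [] := flipP (entry T v); lia.
Qed.

Lemma forked_settled T x : injective T -> forked T x -> below U T x ->
  settled U T b /\ settled U T b.+1.
Proof.
move=> injT /forkedP[w [w' [Nw Nw' <- <-]]] max_x.
by split; apply: (settled_below USYT injT max_x); apply: SYT_Nplus.
Qed.

Lemma consecutive_step T x y : injective T -> exchange U T x y ->
  entry T x = b.+1 -> entry T y = b -> step U T = relabel T.
Proof.
move=> injT exch Tx Ty; rewrite (step_exchange injU injT exch).
apply: filling_ext => z; rewrite entry_relabel.
have [->|zx] := eqVneq z x.
  by rewrite entry_swapL Tx Ty flip_b1.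
have [->|zy] := eqVneq z y; first by rewrite entry_swapR Tx Ty flip_b.
rewrite entry_swapD //.
have := entry_neq injT zx; have := entry_neq injT zy; rewrite Tx Ty.
by have [] := flipP (entry T z); lia.
Qed.

(** Once b + 1 moves down past b, neither of them moves down any more, whether in
the sorting of T or in that of the relabelled tableau, which is the next
tableau of the former. *)
Lemma consecutive_trades T x y a u v : injective T -> exchange U T x y ->
  entry T x = b.+1 -> entry T y = b -> a < b ->
  [/\ ~ trades a b u v T, ~ trades a b.+1 u v T,
      ~ trades a b u v (relabel T) & ~ trades a b.+1 u v (relabel T)].
Proof.
move=> injT exch Tx Ty lt_ab; have Es := consecutive_step injT exch Tx Ty.
have injS := relabel_inj injT.
have set_b : settled U T b by rewrite -Ty; apply: settled_up exch.
have set_b1 : settled U (relabel T) b.+1.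
  by rewrite -Es -Tx; apply: settled_consecutive exch _; rewrite ?Tx ?Ty.
have no_b1 : ~ trades a b.+1 u v (relabel T) by apply: settled_trades => //; lia.
split=> //; first exact: settled_trades.
  move=> /tradesS; rewrite Es => -[|//] /and4P[/eqP Tu /eqP Tv _].
  by rewrite Es entry_relabel Tv flip_b1 => /eqP; lia.
by apply: settled_trades => //; rewrite -Es; apply: (@settled_run _ _ _ _ _ 1).
Qed.

(** Unless b and b + 1 are involved as in consecutive_step or forked, T and the
relabelled tableau exchange the same cells, or else the relabelled tableau
moves b + 1 down past b. *)
Lemma exchange_relabel T x y : injective T -> exchange U T x y -> ~~ forked T x ->
    ~~ ((entry T x == b.+1) && (entry T y == b)) ->
  exchange U (relabel T) x y \/
  exists z w, [/\ exchange U (relabel T) z w,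
    entry (relabel T) z = b.+1 & entry (relabel T) w = b].
Proof.
move=> injT [Ny lt_y min_y max_x] nfork ncons.
have flip_lt u v : u < v -> ~ (v = b.+1 /\ u = b) -> flip u < flip v.
  by have [] := flipP u; have [] := flipP v; lia.
have lt_flip u v : flip u < flip v -> ~ (v = b /\ u = b.+1) -> u < v.
  by have [] := flipP u; have [] := flipP v; lia.
have lt_fy : entry (relabel T) y < entry (relabel T) x.
  by rewrite !entry_relabel; apply: flip_lt => //; case=> /eqP Tx /eqP Ty; rewrite Tx Ty in ncons.
have min_fy w : w \in Nplus x -> entry (relabel T) y <= entry (relabel T) w.
  move=> Nw; rewrite !entry_relabel; have [->//|wy] := eqVneq w y.
  apply/ltnW/flip_lt; last by move=> [Tw Ty]; case/forkedP: nfork; exists y, w.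
  by have := min_y w Nw; have := entry_neq injT wy; lia.
(* The order of neighbours differs in the two tableaux only where one contains
   b and the other b + 1; such a cell may be unsorted after relabelling. *)
have [/existsP[z /existsP[w /and4P[Nw /eqP Tz /eqP Tw Uxz]]]|none] :=
  boolP [exists z, exists w, [&& w \in Nplus z, entry T z == b, entry T w == b.+1
                               & entry U x < entry U z]].
  right; exists z, w.
  have fz : entry (relabel T) z = b.+1 by rewrite entry_relabel Tz flip_b.
  have fw : entry (relabel T) w = b.
    by rewrite entry_relabel Tw flip_b1.
  split=> //; split=> //; first by rewrite fz fw.
    move=> v Nv; rewrite fw entry_relabel.
    have : ~~ (entry T v < entry T z).
      by apply/negP => /(max_x z v Nv); lia.
    by rewrite Tz; have [] := flipP (entry T v); lia.
  move=> z' v Nv lt_v.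
  have [/andP[/eqP Tz' /eqP _]|nbb] := boolP ((entry T z' == b) && (entry T v == b.+1)).
    by rewrite -Tz in Tz'; rewrite (entry_inj injT Tz').
  apply: leq_trans (ltnW Uxz); apply: (max_x z' v Nv).
  by rewrite !entry_relabel in lt_v; apply: lt_flip lt_v _ => -[/eqP Tz' /eqP Tv]; rewrite Tz' Tv in nbb.
left; split=> // z w Nw; rewrite !entry_relabel => lt_fw.
rewrite leqNgt; apply/negP => Uxz.
have /negP : ~~ (entry T w < entry T z) by apply/negP => /(max_x z w Nw); lia.
apply; apply: lt_flip lt_fw _ => -[/eqP Tz /eqP Tw].
case/negP: none; apply/existsP; exists z; apply/existsP; exists w.
by rewrite Nw Tz Tw Uxz.
Qed.

Lemma fixed_trades a c x y T : injective T ->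
  (forall z w, w \in Nplus z -> entry T z < entry T w) -> a < c ->
  ~ trades a c x y T.
Proof.
move=> injT sortT lt_ac.
have [[u [v [[Nv lt_v _ _] _]]]|[_ Es]] := stepP U injT.
  by have := sortT u v Nv; lia.
case=> k; have -> : run U T k = T by elim: k => //= k ->.
by move=> /(trade_exchange injT lt_ac)[Nx lt_x _ _]; have := sortT _ _ Nx; lia.
Qed.

Lemma sorted_trades_relabel a x y T : injective T ->
  (forall z w, w \in Nplus z -> entry T z < entry T w) -> a < b ->
  ~ trades a b.+1 x y (relabel T).
Proof.
move=> injT sortT lt_ab; have injR := relabel_inj injT.
have no_exch u v : ~ exchange U T u v.
  by move=> [Nv lt_v _ _]; have := sortT _ _ Nv; lia.
have [[u [v [exch _]]]|[sortR _]] := stepP U injR; last first.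
  by apply: fixed_trades => //; apply: ltnW.
have [/andP[/eqP Ru /eqP Rv]|ncons] :=
  boolP ((entry (relabel T) u == b.+1) && (entry (relabel T) v == b)).
  by have [] := consecutive_trades x y injR exch Ru Rv lt_ab.
have [fork|nfork] := boolP (forked (relabel T) u).
  have [_ _ _ max_u] := exch; apply: settled_trades => //; first exact: ltnW.
  by have [] := forked_settled injR fork max_u.
have := exchange_relabel injR exch nfork ncons; rewrite relabelK.
by case=> [/no_exch|[z [w [/no_exch]]]].
Qed.

(** The number k only bounds the induction: after k steps T is sorted. *)
Lemma trades_relabel a x y T k : injective T -> run U T k \in SYT n lam ->
  a < b -> trades a b x y T <-> trades a b.+1 x y (relabel T).
Proof.
have no_iff P Q : ~ P -> ~ Q -> P <-> Q by tauto.
move=> injT syt_k lt_ab; have ab1 : a < b.+1 by apply: ltnW.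
elim: k T injT syt_k => [|k IHk] T injT syt_k; have injR := relabel_inj injT.
  have sortT z w := @SYT_Nplus _ _ T z w syt_k.
  by apply: no_iff; [apply: fixed_trades | apply: sorted_trades_relabel].
have [[u [v [exch Es]]]|[sortT _]] := stepP U injT; last first.
  by apply: no_iff; [apply: fixed_trades | apply: sorted_trades_relabel].
have [/andP[/eqP Tu /eqP Tv]|ncons] := boolP ((entry T u == b.+1) && (entry T v == b)).
  by have [? _ _ ?] := consecutive_trades x y injT exch Tu Tv lt_ab; apply: no_iff.
have [fork|nfork] := boolP (forked T u).
  have [_ _ _ max_u] := exch; have [set_b _] := forked_settled injT fork max_u.
  have [_ set_b1] := forked_settled injR (forked_relabel fork) (forked_below injT fork max_u).
  by apply: no_iff; apply: settled_trades.
have [exchR|[z [w [exchR Rz Rw]]]] := exchange_relabel injT exch nfork ncons.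
  have Er : step U (relabel T) = relabel (step U T).
    by rewrite Es relabel_swap; apply: step_exchange.
  rewrite (tradesS a b x y T) (tradesS a b.+1) (trade_relabel x y lt_ab Er) Er.
  have [|IH1 IH2] := IHk (step U T) (@step_inj _ _ _ _ injT); first by rewrite -runSr.
  by split=> -[|]; auto.
have [_ no_b1 no_b _] := consecutive_trades x y injR exchR Rz Rw lt_ab.
by rewrite relabelK in no_b; apply: no_iff.
Qed.

End Independence.

Section ExchangeNumber.

Variables (n : nat) (lam : seq nat) (U : filling n lam).
Hypothesis lam_part : is_partition n lam.
Hypothesis USYT : U \in SYT n lam.
Implicit Types (T : filling n lam) (x y z w : cell lam).

Lemma exchange_number2E a b x y : exchange_number2 U a b x y =
  #|[set T in tableaux n lam | [exists i : 'I_(nsteps U T), trade U a b x y (run U T i)]]|.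
Proof. by []. Qed.

Lemma tradesP a b x y T : T \in tableaux n lam -> a < b ->
  reflect (trades U a b x y T) [exists i : 'I_(nsteps U T), trade U a b x y (run U T i)].
Proof.
move=> tabT lt_ab; apply: (iffP existsP) => [[i tr]|[i tr]]; first by exists i.
have [lt_i|le_i] := ltnP i (nsteps U T); first by exists (Ordinal lt_i).
move: tr; rewrite (run_after lam_part USYT tabT le_i).
have sytT := nps_SYT lam_part USYT tabT.
move=> /(trade_exchange USYT (tableauP (SYT_tableau sytT)) lt_ab)[Nx lt_x _ _].
by have := SYT_Nplus sytT Nx; lia.
Qed.

Lemma exchange_number2S a b x y : 0 < a < b -> b < n ->
  exchange_number2 U a b x y = exchange_number2 U a b.+1 x y.
Proof.
case: b => [|b]; first by rewrite ltn0 andbF.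
move=> /andP[_ lt_ab] lt_bn; pose i := Ordinal (ltnW lt_bn); pose j := Ordinal lt_bn.
have ij : j = i.+1 :> nat by [].
rewrite !exchange_number2E.
rewrite -(card_imset _ (inv_inj (relabelK i j))); apply: eq_card => T.
rewrite -{1}[T](relabelK i j) (mem_imset _ _ (inv_inj (relabelK i j))).
have iff_T : T \in tableaux n lam ->
    trades U a i.+1 x y (relabel i j T) <-> trades U a i.+2 x y T.
  rewrite -(relabel_tableau i j) => tabR.
  rewrite (trades_relabel USYT ij x y (tableauP tabR) (nps_SYT lam_part USYT tabR) lt_ab).
  by rewrite relabelK.
apply/setIdP/setIdP; rewrite relabel_tableau => -[tabT tr]; split=> //.
  apply/(tradesP _ _ tabT (leqW lt_ab))/iff_T => //.
  by apply/tradesP: tr; rewrite ?relabel_tableau.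
have tabR : relabel i j T \in tableaux n lam by rewrite relabel_tableau.
apply/(tradesP _ _ tabR lt_ab)/iff_T => //.
by apply/tradesP: tr => //; apply: ltnW.
Qed.

Lemma exchange_number2_eq a b x y : 0 < a < b -> b <= n ->
  exchange_number2 U a b x y = exchange_number U a x y.
Proof.
move=> /andP[a0 /subnKC <-]; rewrite /exchange_number.
elim: (b - _) => [|d IHd] le_n; first by rewrite addn0.
by rewrite addnS -exchange_number2S ?IHd //; lia.
Qed.

End ExchangeNumber.

(** * The turning point of an entry *)

Section Turning.

Variables (n : nat) (lam : seq nat) (U : filling n lam).
Implicit Types (T : filling n lam) (x y z w : cell lam).

(** Before time t, the entry b never moves up in the sorting of T. *)
Definition rising_free T b t :=
  forall i x y, i < t -> exchange U (run U T i) x y -> entry (run U T i) y <> b.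

Lemma rising_free_height T b t i x y : T \in tableaux n lam ->
  rising_free T b t -> i <= t -> entry (run U T i) x = b -> entry (run U T t) y = b ->
  x = y \/ height x < height y.
Proof.
move=> tabT free_t /subnKC; move: (t - i) => d Et; rewrite -{t}Et in free_t *.
have injr j := @run_inj _ _ U T j (tableauP tabT).
move=> Tx; elim: d y free_t => [|d IHd] y free_t.
  by rewrite addn0 -Tx => /(entry_inj (@injr i)); left.
have free_d : rising_free T b (i + d).
  by move=> j u v lt_j; apply: free_t; rewrite addnS ltnS ltnW.
rewrite addnS /= -/(run U T (i + d)) => Sy; set R := run U T (i + d) in Sy.
have [lt_y|gt_y|Ry] := ltngtP (entry R y) (entry (step U R) y).
- have [u exch Eu] := step_gt (@injr _) lt_y; have [Ny _ _ _] := exch.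
  have Ru : entry R u = b by rewrite -Eu.
  right; rewrite (Nplus_height Ny) ltnS.
  by have [->|/ltnW] := IHd u free_d Ru.
- have [v exch Ev] := step_lt (@injr _) gt_y.
  by have [] := free_t (i + d) _ _ _ exch; rewrite ?addnS // -Ev.
- by apply: IHd => //; rewrite -/R Ry.
Qed.

Lemma settled_height T b t k x y : T \in tableaux n lam ->
  settled U (run U T t) b -> entry (run U T t) x = b -> entry (run U T (t + k)) y = b ->
  x = y \/ height y < height x.
Proof.
move=> tabT set_t Tx; have injr j := @run_inj _ _ U T j (tableauP tabT).
elim: k y => [|k IHk] y.
  by rewrite addn0 -Tx => /(entry_inj (@injr t)); left.
rewrite addnS /= -/(run U T (t + k)) => Sy; set R := run U T (t + k) in Sy.
have [lt_y|gt_y|Ry] := ltngtP (entry R y) (entry (step U R) y).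
- have [u exch Eu] := step_gt (@injr _) lt_y.
  by have [] := set_t k u y; rewrite -runD // -Eu.
- have [v exch Ev] := step_lt (@injr _) gt_y; have [Nv _ _ _] := exch.
  have Rv : entry R v = b by rewrite -Ev.
  by right; have := Nplus_height Nv; case: (IHk v Rv) => [->|]; lia.
- by apply: IHk; rewrite -/R Ry.
Qed.

(** The entry a arrives in x as often as it leaves x, up to the difference between
its initial and final position. *)
Lemma flow_balance T a x : T \in tableaux n lam ->
  \sum_(i < nsteps U T) ((entry (run U T i) x != a) && (entry (run U T i.+1) x == a))
    + (entry T x == a) =
  \sum_(i < nsteps U T) ((entry (run U T i) x == a) && (entry (run U T i.+1) x != a))
    + (entry (nps U T) x == a).
Proof.
move=> tabT; rewrite /nps; elim: (nsteps U T) => [|r IHr]; first by rewrite !big_ord0.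
by rewrite !big_ord_recr /= in IHr *; rewrite -/(run U T r) in IHr *; lia.
Qed.

Hypothesis USYT : U \in SYT n lam.

Let injU : injective U.
Proof. exact: tableauP (SYT_tableau USYT). Qed.

Lemma exchange_uniq T x y x' y' : injective T ->
  exchange U T x y -> exchange U T x' y' -> x = x' /\ y = y'.
Proof.
move=> injT [Ny lt_y min_y max_x] [Ny' lt_y' min_y' max_x'].
have Ex : x = x'.
  apply: (entry_inj injU); apply/eqP; rewrite eqn_leq.
  by rewrite (max_x' x y) // (max_x x' y').
rewrite -{}Ex in Ny' lt_y' min_y' max_x' *; split=> //.
by apply: (entry_inj injT); apply/eqP; rewrite eqn_leq min_y // min_y'.
Qed.

Hypothesis lam_part : is_partition n lam.

(** The time t is that of the first upward move of b, or the end. *)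
Lemma turning_point T b : T \in tableaux n lam ->
  exists t, [/\ t <= nsteps U T, rising_free T b t & settled U (run U T t) b].
Proof.
move=> tabT; have injr i := @run_inj _ _ U T i (tableauP tabT).
have [t [le_t free_t set_t]] : exists t, [/\ t <= nsteps U T, rising_free T b t &
    t = nsteps U T \/ settled U (run U T t) b].
  elim: (nsteps U T) => [|r [t [le_t free_t [Et|set_t]]]].
  - by exists 0; split=> //; left.
  - rewrite Et in free_t; have [[x [y [exch _]]]|[sortT _]] := stepP U (injr r).
      have [yb|yb] := eqVneq (entry (run U T r) y) b.
        by exists r; split=> //; right; rewrite -yb; apply: settled_up exch.
      exists r.+1; split=> //; last by left.
      move=> i u v; rewrite ltnS leq_eqVlt => /orP[/eqP->|]; last exact: free_t.
      by move=> /(exchange_uniq (@injr r) exch)[_ <-]; apply/eqP.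
    exists r.+1; split=> //; last by left.
    move=> i u v; rewrite ltnS leq_eqVlt => /orP[/eqP->|]; last exact: free_t.
    by move=> [Nv lt_v _ _]; have := sortT u v Nv; lia.
  - by exists t; split=> //; [apply: leqW | right].
exists t; split=> //; case: set_t => // -> k x y; rewrite -runD.
rewrite (run_after lam_part USYT tabT) ?leq_addr //.
by move=> [Ny lt_y _ _]; have := SYT_Nplus (nps_SYT lam_part USYT tabT) Ny; lia.
Qed.

(** The drop of b is its position at the turning point: at any other time it is
in the same cell or at smaller height. *)
Lemma is_drop_turning T b t x : T \in tableaux n lam -> 1 <= b <= n ->
  t <= nsteps U T -> rising_free T b t -> settled U (run U T t) b ->
  is_drop U b x T = (entry (run U T t) x == b).
Proof.
move=> tabT b_n le_t free_t set_t.
have injr j : injective (run U T j) by apply/tableauP/run_tableau.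
have [p Tp] := entry_exists (run_tableau U t tabT) b_n.
have height_le i y : entry (run U T i) y = b -> y = p \/ height y < height p.
  move=> Ty; have [le_it|/ltnW/subnKC Ei] := leqP i t.
    exact: (rising_free_height tabT free_t le_it Ty Tp).
  by rewrite -Ei in Ty; have [->|] := settled_height tabT set_t Tp Ty; [left | right].
have max_h : max_height U b T = height p.
  apply/eqP; rewrite eqn_leq; apply/andP; split.
    apply/bigmax_leqP => i _.
    have [y Ty] := entry_exists (run_tableau U i tabT) b_n.
    rewrite (entry_heightE (@injr i) Ty).
    by have [->|/ltnW] := height_le i y Ty.
  rewrite -(entry_heightE (@injr t) Tp).
  exact: (leq_bigmax (Ordinal (le_t : t < (nsteps U T).+1))).
rewrite /is_drop max_h; apply/andP/eqP => [[/eqP hx /existsP[i /eqP Tx]]|Tx].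
  by have [->//|] := height_le i x Tx; rewrite hx ltnn.
have -> : x = p by apply: (entry_inj (@injr t)); rewrite Tp.
by split=> //; apply/existsP; exists (Ordinal (le_t : t < (nsteps U T).+1)); rewrite /= Tp.
Qed.

(** Trades with smaller entries move b into x as often as out of x, up to the
difference between its position at time 0 and at the turning point. *)
Lemma drop_balance T b x : T \in tableaux n lam -> 1 <= b <= n ->
  \sum_(i < nsteps U T) ((entry (run U T i) x < b) && (entry (run U T i.+1) x == b))
    + (entry T x == b) =
  \sum_(i < nsteps U T) ((entry (run U T i) x == b) && (entry (run U T i.+1) x < b))
    + is_drop U b x T.
Proof.
move=> tabT b_n; have [t [le_t free_t set_t]] := turning_point b tabT.
have injr j : injective (run U T j) by apply/tableauP/run_tableau.
rewrite (is_drop_turning x tabT b_n le_t free_t set_t).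
rewrite -[in RHS](minn_idPr le_t); elim: (nsteps U T) => [|r IHr].
  by rewrite !big_ord0 min0n.
rewrite !big_ord_recr /=; set R := run U T r in IHr *.
have [lt_rt|le_tr] := ltnP r t.
  rewrite (minn_idPl lt_rt) (minn_idPl (ltnW lt_rt)) /= -/R in IHr *.
  suff : (entry R x == b) + ((entry R x < b) && (entry (step U R) x == b)) =
    ((entry R x == b) && (entry (step U R) x < b)) + (entry (step U R) x == b) by lia.
  have [lt_x|gt_x|->] := ltngtP (entry R x) (entry (step U R) x); last by lia.
    have [u exch Eu] := step_gt (@injr _) lt_x.
    by have := free_t r u x lt_rt exch; rewrite -/R; lia.
  have [v exch Ev] := step_lt (@injr _) gt_x.
  by have := free_t r x v lt_rt exch; rewrite -/R in Ev *; lia.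
rewrite (minn_idPr le_tr) (minn_idPr (leqW le_tr)) in IHr *.
suff [-> ->] : ((entry R x < b) && (entry (step U R) x == b)) = false /\
  ((entry R x == b) && (entry (step U R) x < b)) = false by rewrite !addn0.
have no_fall u v : exchange U R u v -> entry R u <> b.
  by have := set_t (r - t) u v; rewrite -runD subnKC.
split; apply/negP => /andP[].
  move=> lt_x /eqP Sx; rewrite -Sx in lt_x.
  by have [u exch Eu] := step_gt (@injr _) lt_x; case: (no_fall _ _ exch); rewrite -Eu.
move=> /eqP Rx lt_x; rewrite -Rx in lt_x.
by have [v exch _] := step_lt (@injr _) lt_x; case: (no_fall _ _ exch).
Qed.

End Turning.

(** * Counting the entries that pass through a cell *)

Section Sums.

Variables (n : nat) (lam : seq nat) (U : filling n lam).
Implicit Types (T : filling n lam) (x y z w : cell lam).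

(** The number of steps, over the sortings of all tableaux, in which the entry of
x satisfies p before the step and q after the step. *)
Definition passages (p q : pred nat) x : nat :=
  \sum_(T in tableaux n lam) \sum_(i < nsteps U T)
     (p (entry (run U T i) x) && q (entry (run U T i.+1) x)).

Lemma eq_passages p p' q q' x : (forall v, 0 < v <= n -> p v = p' v) ->
  (forall v, 0 < v <= n -> q v = q' v) -> passages p q x = passages p' q' x.
Proof.
move=> Ep Eq; apply: eq_bigr => T _; apply: eq_bigr => i _.
by rewrite Ep ?Eq //; apply: ltn_ord.
Qed.

Lemma sum_pred1 m k v : \sum_(m <= a < k) (v == a : nat) = (m <= v < k).
Proof.
rewrite -mem_index_iota -(count_uniq_mem _ (iota_uniq _ _)) -sum1_count.
by rewrite [RHS]big_mkcond /=; apply: eq_bigr => a _; rewrite eq_sym.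
Qed.

Lemma sum_passages_l m k q x :
  \sum_(m <= a < k) passages (pred1 a) q x = passages (fun v => m <= v < k) q x.
Proof.
rewrite exchange_big; apply: eq_bigr => T _; rewrite exchange_big; apply: eq_bigr => i _ /=.
case: (q _); first by under eq_bigr do rewrite andbT; rewrite sum_pred1 andbT.
by rewrite andbF big1 // => a _; rewrite andbF.
Qed.

Lemma sum_passages_r m k p x :
  \sum_(m <= a < k) passages p (pred1 a) x = passages p (fun v => m <= v < k) x.
Proof.
rewrite exchange_big; apply: eq_bigr => T _; rewrite exchange_big; apply: eq_bigr => i _ /=.
by case: (p _); [rewrite /= sum_pred1 | rewrite big1].
Qed.

Lemma passagesUl p p' q x : (forall v, ~~ (p v && p' v)) ->
  passages (predU p p') q x = passages p q x + passages p' q x.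
Proof.
move=> dis; rewrite -big_split; apply: eq_bigr => T _; rewrite -big_split; apply: eq_bigr => i _ /=.
by have := dis (entry (run U T i) x); case: (p _); case: (p' _); case: (q _).
Qed.

Lemma passagesUr p q q' x : (forall v, ~~ (q v && q' v)) ->
  passages p (predU q q') x = passages p q x + passages p q' x.
Proof.
move=> dis; rewrite -big_split; apply: eq_bigr => T _; rewrite -big_split; apply: eq_bigr => i _ /=.
by have := dis (entry (step U (run U T i)) x); case: (p _); case: (q _); case: (q' _).
Qed.

(** If the entry of x changes from a to b, exactly one cell y takes part. *)
Lemma sum_trade T a b x : injective T -> a != b ->
  \sum_y (trade U a b x y T : nat) = (entry T x == a) && (entry (step U T) x == b).
Proof.
move=> injT ab; have [/andP[/eqP Tx /eqP Sx]|no] := boolP (_ && _); last first.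
  by rewrite big1 // => y _; apply/eqP; rewrite eqb0; apply: contra no => /and4P[-> _ ->].
have [y [Ty Sy]] : exists y, entry T y = b /\ entry (step U T) y = a.
  have [[u [v [exch E]]]|[_ E]] := stepP U injT; last by rewrite -Tx -Sx E eqxx in ab.
  rewrite E in Sx *; have [xu|xu] := eqVneq x u.
    by exists v; rewrite -Tx -Sx xu entry_swapL entry_swapR.
  have [xv|xv] := eqVneq x v.
    by exists u; rewrite -Tx -Sx xv entry_swapL entry_swapR.
  by rewrite -Tx -Sx entry_swapD // eqxx in ab.
rewrite (bigD1 y) //= big1 ?addn0 => [|z zy]; first by rewrite /trade Tx Ty Sx Sy !eqxx.
apply/eqP; rewrite eqb0; apply: contra zy => /and4P[_ /eqP Tz _ _]; apply/eqP.
by apply: (entry_inj injT); rewrite Ty.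
Qed.

Lemma tradeC T a b x y : trade U a b x y T = trade U b a y x T.
Proof. by rewrite /trade; do 4!case: (_ == _). Qed.

Hypothesis USYT : U \in SYT n lam.

(** A trade of given entries in given cells happens at most once in a sorting: its
second occurrence would require b to move up in between. *)
Lemma trade_inj T a b x y i j : T \in tableaux n lam -> 0 < a < b ->
  trade U a b x y (run U T i) -> trade U a b x y (run U T j) -> i = j.
Proof.
move=> tabT /andP[a0 lt_ab]; have injr k : injective (run U T k).
  exact/tableauP/run_tableau.
wlog: i j / i <= j => [wl tri trj|le_ij].
  have [le_ij|/ltnW le_ji] := leqP i j; first exact: wl.
  by apply/esym/wl.
move=> tri trj; have exi := trade_exchange USYT (@injr i) lt_ab tri.
have exj := trade_exchange USYT (@injr j) lt_ab trj.
have [_ /eqP Tiy /eqP Tix _] := and4P tri; have [_ /eqP Tjy _ _] := and4P trj.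
apply/eqP; rewrite eqn_leq le_ij leqNgt; apply/negP => lt_ij.
have free_j : rising_free U T b j.
  move=> k u v lt_kj exk Tkv.
  have set_k : settled U (run U T k) b by rewrite -Tkv; apply: settled_up exk.
  by apply: (set_k (j - k) y x); rewrite -runD subnKC // ltnW.
have [Nx _ _ _] := exi; have := Nplus_height Nx.
by have [->|] := rising_free_height tabT free_j lt_ij Tix Tjy; lia.
Qed.

(** An exchange number, defined by counting tableaux, also counts exchanges. *)
Lemma exchange_number2_sum a b x y : 0 < a < b -> exchange_number2 U a b x y =
  \sum_(T in tableaux n lam) \sum_(i < nsteps U T) trade U a b x y (run U T i).
Proof.
move=> ab; have [a0 lt_ab] := andP ab; rewrite exchange_number2E -sum1dep_card big_mkcondr /=.
apply: eq_bigr => T tabT; case: existsP => [[i tr]|no].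
  rewrite (bigD1 i) //= tr big1 // => j ji; apply/eqP; rewrite eqb0; apply: contra ji => trj.
  exact/eqP/val_inj/(trade_inj tabT ab trj tr).
by rewrite big1 // => i _; apply/eqP; rewrite eqb0; apply/negP => tr; apply: no; exists i.
Qed.

Hypothesis lam_part : is_partition n lam.

(** The sum over N^-(x) may be extended to all cells, since the smaller entry a
leaves x upwards or to the left. *)
Lemma sum_exchange_number_Nminus a b x : 0 < a < b -> b <= n ->
  \sum_(y in Nminus x) exchange_number U a x y = passages (pred1 a) (pred1 b) x.
Proof.
move=> ab le_bn; have [a0 lt_ab] := andP ab.
under eq_bigr => y _ do
  rewrite -(exchange_number2_eq lam_part USYT x y ab le_bn) exchange_number2_sum //.
rewrite exchange_big; apply: eq_bigr => T tabT; rewrite exchange_big; apply: eq_bigr => i _ /=.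
have injR : injective (run U T i) by apply/tableauP/run_tableau.
rewrite -(@sum_trade _ a b x injR) ?neq_ltn ?lt_ab // big_mkcond; apply: eq_bigr => y _ /=.
case: ifPn => // Ny; apply/esym/eqP; rewrite eqb0; apply: contra Ny => tr.
by have [Nx _ _ _] := trade_exchange USYT injR lt_ab tr; rewrite mem_Nminus.
Qed.

Lemma sum_exchange_number_Nplus a b x : 0 < a < b -> b <= n ->
  \sum_(y in Nplus x) exchange_number U a y x = passages (pred1 b) (pred1 a) x.
Proof.
move=> ab le_bn; have [a0 lt_ab] := andP ab.
under eq_bigr => y _ do
  rewrite -(exchange_number2_eq lam_part USYT y x ab le_bn) exchange_number2_sum //.
rewrite exchange_big; apply: eq_bigr => T tabT; rewrite exchange_big; apply: eq_bigr => i _ /=.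
have injR : injective (run U T i) by apply/tableauP/run_tableau.
rewrite -(@sum_trade _ b a x injR) ?neq_ltn ?lt_ab ?orbT // big_mkcond; apply: eq_bigr => y _ /=.
rewrite tradeC; case: ifPn => // Ny; apply/esym/eqP; rewrite eqb0; apply: contra Ny => tr.
by rewrite tradeC in tr; have [] := trade_exchange USYT injR lt_ab tr.
Qed.

Import GRing.Theory.

(** The signed exit number of a is the net number of changes from a to b of the
entry of x, for any larger entry b. *)
Lemma signed_exit_passages a b x : 0 < a < b -> b <= n ->
  signed_exit U a x = ((passages (pred1 a) (pred1 b) x)%:Z - (passages (pred1 b) (pred1 a) x)%:Z)%R.
Proof.
move=> ab le_bn; rewrite -(sum_exchange_number_Nminus x ab le_bn).
by rewrite -(sum_exchange_number_Nplus x ab le_bn) /signed_exit !raddf_sum.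
Qed.

Lemma drop_signed_exit x b : 0 < b <= n ->
  ((drop_function U b x)%:Z = (\sum_(T in tableaux n lam) (entry T x == b))%:Z
     + \sum_(1 <= a < b) signed_exit U a x)%R.
Proof.
move=> b_n; have [b0 le_bn] := andP b_n.
have -> : (\sum_(1 <= a < b) signed_exit U a x =
    (passages (fun v => 1 <= v < b)%N (pred1 b) x)%:Z
    - (passages (pred1 b) (fun v => 1 <= v < b)%N x)%:Z)%R.
  rewrite -sum_passages_l -sum_passages_r !raddf_sum -big_split; apply: eq_big_nat => a.
  by move=> ab; apply: signed_exit_passages.
have lt_b v : 0 < v <= n -> (1 <= v < b) = (v < b) by lia.
rewrite (eq_passages (p' := fun v => v < b) (q' := pred1 b)) //.
rewrite (eq_passages (p := pred1 b) (p' := pred1 b) (q' := fun v => v < b)) //.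
have : passages (fun v => v < b) (pred1 b) x + \sum_(T in tableaux n lam) (entry T x == b)
    = passages (pred1 b) (fun v => v < b) x + drop_function U b x.
  by rewrite -!big_split; apply: eq_bigr => T tabT; apply: drop_balance.
by lia.
Qed.

(** By signed_exit_passages, each of the n - a entries larger than a contributes
the same amount to the flow of a. *)
Lemma flow_signed_exit x a : 0 < a < n ->
  ((n - a)%:Z * signed_exit U a x = \sum_(1 <= c < a) signed_exit U c x
     + (\sum_(T in tableaux n lam) (entry T x == a))%:Z
     - (\sum_(T in tableaux n lam) (entry (nps U T) x == a))%:Z)%R.
Proof.
move=> a_n; have [a0 lt_an] := andP a_n.
have -> : ((n - a)%:Z * signed_exit U a x =
    (passages (pred1 a) (fun v => a.+1 <= v < n.+1)%N x)%:Z
    - (passages (fun v => a.+1 <= v < n.+1)%N (pred1 a) x)%:Z)%R.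
  rewrite -sum_passages_l -sum_passages_r !raddf_sum -big_split.
  rewrite (eq_big_nat _ _ (F2 := fun=> signed_exit U a x)) => [|b /andP[lt_ab lt_bn]].
    by rewrite sumr_const_nat subSS -mulr_natl natz.
  by apply/esym/signed_exit_passages; rewrite ?a0.
have -> : (\sum_(1 <= c < a) signed_exit U c x =
    (passages (fun v => 1 <= v < a)%N (pred1 a) x)%:Z
    - (passages (pred1 a) (fun v => 1 <= v < a)%N x)%:Z)%R.
  rewrite -sum_passages_l -sum_passages_r !raddf_sum -big_split; apply: eq_big_nat => c.
  by move=> ca; apply: signed_exit_passages => //; apply: ltnW.
have : passages (predC1 a) (pred1 a) x + \sum_(T in tableaux n lam) (entry T x == a)
    = passages (pred1 a) (predC1 a) x + \sum_(T in tableaux n lam) (entry (nps U T) x == a).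
  by rewrite -!big_split; apply: eq_bigr => T tabT; apply: flow_balance.
have neq_a v : 0 < v <= n ->
    predC1 a v = predU (fun v => 1 <= v < a) (fun v => a.+1 <= v < n.+1) v.
  by move=> /= v_n; lia.
rewrite (eq_passages (q' := pred1 a) _ neq_a) // (eq_passages (p' := pred1 a) _ _ neq_a) //.
by rewrite passagesUl ?passagesUr; lia.
Qed.

End Sums.

(** * Initial and final tableaux *)

Section Initial.

Variables (n : nat) (lam : seq nat).
Hypothesis lam_part : is_partition n lam.

Lemma card_cell : #|cell lam| = n.
Proof.
have /and3P[_ _ /eqP <-] := lam_part; rewrite card_tagged; congr sumn.
apply: (@eq_from_nth _ 0); rewrite size_map size_enum_ord // => i lt_i.
by rewrite (nth_map (Ordinal lt_i)) ?size_enum_ord // card_ord nth_enum_ord.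
Qed.

Lemma card_tableaux : #|tableaux n lam| = n`!.
Proof.
have := card_inj_ffuns (cell lam) 'I_n; rewrite card_cell card_ord ffactnn => <-.
apply: eq_card => T.
rewrite !inE; case: injectiveP => //= injT; apply/forallP => k.
by apply: inj_card_onto => //; rewrite card_ord card_cell.
Qed.

Lemma sum_entry_eq (x : cell lam) b : 0 < b <= n ->
  \sum_(T in tableaux n lam) (entry T x == b) = (n.-1)`!.
Proof.
case: b => // b /= lt_b; pose C (k : 'I_n) := \sum_(T in tableaux n lam) (T x == k).
(* Transposing two values permutes the tableaux. *)
have CE k l : C k = C l.
  rewrite /C (reindex_inj (inv_inj (relabelK k l))).
  apply: eq_big => T; first by rewrite relabel_tableau.
  by move=> _; rewrite ffunE -{2}(tpermR k l) (inj_eq perm_inj).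
have : \sum_k C k = n`!.
  rewrite exchange_big -card_tableaux -sum1_card; apply: eq_bigr => T _ /=.
  rewrite (bigD1 (T x)) //= eqxx big1 // => k.
  by rewrite eq_sym => /negbTE->.
rewrite (eq_bigr (fun=> C (Ordinal lt_b))) ?sum_nat_const ?card_ord => [|k _]; last exact: CE.
have n0 : 0 < n by apply: leq_ltn_trans lt_b.
have -> : n`! = n * (n.-1)`! by rewrite -[in LHS](prednK n0) factS prednK.
move/eqP; rewrite eqn_pmul2l // => /eqP <-.
by apply: eq_bigr.
Qed.

Lemma sum_nps_entry (U : filling n lam) (x : cell lam) b : U \in SYT n lam ->
  \sum_(T in tableaux n lam) (entry (nps U T) x == b) =
  \sum_(W in SYT n lam) distribution U W * (entry W x == b).
Proof.
move=> USYT; rewrite (partition_big (nps U) [in SYT n lam]) => [|T]; last exact: nps_SYT.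
apply: eq_bigr => W _; rewrite /distribution -sum1dep_card big_distrl /=.
by apply: eq_bigr => T /andP[_ /eqP->]; rewrite mul1n.
Qed.

Import GRing.Theory.

Lemma signed_exit_equidistributed (U V : filling n lam) (x : cell lam) a :
  U \in SYT n lam -> V \in SYT n lam -> distribution_vector U = distribution_vector V ->
  0 < a < n -> signed_exit U a x = signed_exit V a x.
Proof.
move=> US VS eqZ; elim/ltn_ind: a => a IHa a_n; have [a0 lt_an] := andP a_n.
have eq_dist W : W \in SYT n lam -> distribution U W = distribution V W.
  by move=> SW; have /ffunP/(_ (exist _ W SW)) := eqZ; rewrite !ffunE.
have nz : ((n - a)%:Z != 0)%R by lia.
apply: (mulfI nz); rewrite !flow_signed_exit // !sum_nps_entry //.
congr (_ + _ - _%:Z)%R; last by apply: eq_bigr => W SW; rewrite eq_dist.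
apply: eq_big_nat => c /andP[c0 lt_ca]; apply: IHa => //.
by rewrite c0 (ltn_trans lt_ca).
Qed.

End Initial.

Theorem corollary5p4 (n : nat) (lam : seq nat) (hlam : is_partition n lam) :
  (forall U : filling n lam, U \in SYT n lam ->
     forall (x : cell lam) (b : nat), 1 <= b <= n ->
       ((drop_function U b x)%:Z
        = (n.-1)`!%:Z + \sum_(1 <= a < b) signed_exit U a x)%R)
  /\
  (forall U V : filling n lam, U \in SYT n lam -> V \in SYT n lam ->
     distribution_vector U = distribution_vector V ->
     forall (x : cell lam) (b : nat), 1 <= b <= n ->
       drop_function U b x = drop_function V b x).
Proof.
have drop_formula U x b : U \in SYT n lam -> 1 <= b <= n ->
    ((drop_function U b x)%:Z
     = (n.-1)`!%:Z + \sum_(1 <= a < b) signed_exit U a x)%R.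
  by move=> US b_n; rewrite drop_signed_exit // sum_entry_eq.
split=> [U US x b|U V US VS eqZ x b b_n]; first exact: drop_formula.
suff : (drop_function U b x)%:Z%R = (drop_function V b x)%:Z%R by case.
rewrite !drop_formula //; congr (_ + _)%R; apply: eq_big_nat => a /andP[a0 lt_ab].
apply: signed_exit_equidistributed => //; rewrite a0.
by apply: leq_trans lt_ab _; have /andP[] := b_n.
Qed.
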